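(* Let $G$ and $H$ be finite simple connected graphs, neither of which is a complete graph. Then $th(G\boxtimes H)=2$.
   Context: The strong product $G\boxtimes H$ has vertex set $V(G)\times V(H)$; $(g_1,h_1)$ and $(g_2,h_2)$ are adjacent iff ($g_1g_2\in E(G)$ and $h_1=h_2$) or ($g_1=g_2$ and $h_1h_2\in E(H)$) or ($g_1g_2\in E(G)$ and $h_1h_2\in E(H)$). For two different non-adjacent vertices $u,v$ of a graph $F$, a tolled walk between $u$ and $v$ is a sequence of vertices $u,w_1,\dots,w_k,v$ with $k\ge 1$ such that consecutive vertices of $w_1,\dots,w_k$ are adjacent, $uw_i\in E(F)$ if and only if $i=1$, and $vw_i\in E(F)$ if and only if $i=k$. If $uv\in E(F)$, the only tolled walk between $u$ and $v$ is $u,v$; the only tolled walk from $v$ to itself is the single vertex $v$. The toll interval $T_F(u,v)$ is the set of all vertices of $F$ lying on some tolled walk between $u$ and $v$. A set $S\subseteq V(F)$ is toll convex (t-convex) if $T_F(u,v)\subseteq S$ for all $u,v\in S$. The t-convex hull $[S]_t$ of $S\subseteq V(F)$ is the intersection of all t-convex sets containing $S$. $S$ is a t-hull set of $F$ if $[S]_t=V(F)$, and the t-hull number $th(F)$ is the minimum size of a t-hull set of $F$. *)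

(* Defs.v *)
From mathcomp Require Import all_boot.
From mathcomp Require Import boolp.

Set Implicit Arguments.
Unset Strict Implicit.
Unset Printing Implicit Defensive.

Reserved Notation "x -- y" (at level 30).

Record sgraph := SGraph {
  vertex :> finType;
  adj : rel vertex;
  adj_sym : symmetric adj;
  adj_irrefl : irreflexive adj
}.

Notation "x -- y" := (adj x y).

(* The graph on no vertices is vacuously connected, but it is also complete. *)
Definition connected_graph (G : sgraph) : Prop :=
  forall x y : G, connect (@adj G) x y.

Definition complete_graph (G : sgraph) : Prop :=
  forall x y : G, x != y -> x -- y.

Section StrongProduct.

Variables G H : sgraph.

Definition strong_adj (x y : G * H) : bool :=
  [|| (x.1 -- y.1) && (x.2 == y.2),
      (x.1 == y.1) && (x.2 -- y.2) |
      (x.1 -- y.1) && (x.2 -- y.2)].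

Lemma strong_adj_sym : symmetric strong_adj.
Proof.
move=> x y; rewrite /strong_adj (adj_sym x.1) (adj_sym x.2).
by rewrite (eq_sym x.1) (eq_sym x.2).
Qed.

Lemma strong_adj_irrefl : irreflexive strong_adj.
Proof. by move=> x; rewrite /strong_adj !adj_irrefl !andbF. Qed.

Definition strong_product : sgraph := SGraph strong_adj_sym strong_adj_irrefl.

End StrongProduct.

Section TollConvexity.

Variable F : sgraph.

(* The sequence w = (w_1, ..., w_k) is indexed from 0 here, so that w_i is    *)
(* [nth u w i.-1]; the default value u is never reached.                      *)
Definition tolled_interior (u v : F) (w : seq F) : Prop :=
  [/\ 1 <= size w,
      sorted (@adj F) w,
      forall i, i < size w -> (u -- nth u w i <-> i = 0) &
      forall i, i < size w -> (v -- nth u w i <-> i = (size w).-1)].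

Definition tolled_walk (u v : F) (p : seq F) : Prop :=
  if u == v then p = [:: u]
  else if u -- v then p = [:: u; v]
  else exists2 w, tolled_interior u v w & p = u :: rcons w v.

Definition toll_interval (u v : F) : {set F} :=
  [set x | `[< exists2 p, tolled_walk u v p & x \in p >]].

Definition t_convex (S : {set F}) : bool :=
  [forall u in S, forall v in S, toll_interval u v \subset S].

Definition t_hull (S : {set F}) : {set F} :=
  \bigcap_(C : {set F} | t_convex C && (S \subset C)) C.

Definition t_hull_set (S : {set F}) : bool := t_hull S == [set: F].

Lemma t_hull_set_exists : exists n, [exists S, t_hull_set S && (#|S| == n)].
Proof.
exists #|[set: F]|; apply/existsP; exists setT; rewrite eqxx andbT.
rewrite /t_hull_set eqEsubset subsetT /=.
by apply/bigcapsP => C /andP[].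
Qed.

Definition t_hull_number : nat := ex_minn t_hull_set_exists.

End TollConvexity.

(* Main.v *)
(** Let [g1], [g2] be distinct non-adjacent vertices of [G] and [h1], [h2] of
    [H].  When neither [g] nor [h] is universal, the complement of the closed
    neighbourhood N[(g,h)] = N[g] x N[h] is connected.  Hence the toll interval
    of (g1,h1) and (g2,h2) contains every [x] whose closed neighbourhood lies
    neither in N[(g1,h1)] nor in N[(g2,h2)].  In particular it contains (g1,h2)
    and (g2,h1), and the toll interval of these two vertices contains
    everything that the first interval may have missed. *)

Require Import Defs.
From mathcomp Require Import all_boot.
From mathcomp Require Import boolp.

Set Implicit Arguments.
Unset Strict Implicit.
Unset Printing Implicit Defensive.

Lemma connect_homo (T T' : finType) (e : rel T) (e' : rel T') (f : T -> T') :
  {homo f : x y / e x y >-> e' x y} ->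
  {homo f : x y / connect e x y >-> connect e' x y}.
Proof.
move=> fe x y /connectP[p].
elim: p x => [|z p IHp] x /= => [_ -> //|/andP[exz pzp] yE].
exact: connect_trans (connect1 (fe _ _ exz)) (IHp _ pzp yE).
Qed.

Section Graph.

Variable F : sgraph.
Implicit Types u v x y : F.

Definition closed_adj : rel F := fun x y => (x == y) || (x -- y).

(** Only the end of a step is kept outside N[v], so that a path may start at a vertex of N[v]. *)
Definition step_avoiding v : rel F := fun x y => (x -- y) && ~~ closed_adj v y.

Lemma closed_adj_refl : reflexive closed_adj.
Proof. by move=> x; rewrite /closed_adj eqxx. Qed.

Lemma closed_adj_sym : symmetric closed_adj.
Proof. by move=> x y; rewrite /closed_adj eq_sym adj_sym. Qed.

Lemma not_complete_graphP :
  ~ complete_graph F -> exists x y, ~~ closed_adj x y.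
Proof.
move=> ncF; apply: contrapT => noxy; apply: ncF => x y nxy.
by apply: contrapT => /negP xy; apply: noxy; exists x, y; rewrite negb_or nxy.
Qed.

(* Cut the path at its first vertex adjacent to [u]. *)
Lemma first_neighbour (e : rel F) u x :
  subrel e (@adj F) -> x != u -> connect e x u ->
  exists p, [/\ path e x p, u -- last x p
             & all (fun y => ~~ (u -- y)) (belast x p)].
Proof.
move=> eF xu /connectP[p]; elim: p x xu => [|y p IHp] x xu /=.
  by move=> _ uE; rewrite uE eqxx in xu.
move=> /andP[exy pyp] uE; have [ux|nux] := boolP (u -- x); first by exists [::].
have yu : y != u by apply: contraNneq nux => <-; rewrite adj_sym eF.
have [q [pyq uq allq]] := IHp y yu pyp uE.
by exists (y :: q); rewrite /= exy pyq nux.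
Qed.

Lemma avoiding_all v x p :
  path (step_avoiding v) x p -> all (fun y => ~~ (v -- y)) p.
Proof.
elim: p x => //= y p IHp x /andP[/andP[_ nvy] /IHp ->].
by rewrite andbT; apply: contra nvy => vy; rewrite /closed_adj vy orbT.
Qed.

(** The first step of a path leaving [u] would enter N[u], and the empty path cannot reach [v] from
    [u]. *)
Lemma step_avoiding_neq u v x :
  ~~ closed_adj u v -> connect (step_avoiding u) x v -> x != u.
Proof.
move=> nuv /connectP[[|y p] /= pxp vE].
  by apply: contraNneq nuv => <-; rewrite vE closed_adj_refl.
apply: contraTneq pxp => ->.
by rewrite /step_avoiding /closed_adj; case: (u -- y); rewrite ?orbT.
Qed.

(** Both paths are cut at their first neighbour of [u], respectively [v]. The first one reversed,
    followed by the second, is the interior of a tolled walk through [x]. *)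
Lemma mem_toll_interval u v x :
  ~~ closed_adj u v ->
  connect (step_avoiding v) x u -> connect (step_avoiding u) x v ->
  x \in toll_interval u v.
Proof.
move=> nuv xu xv.
have subF w : subrel (step_avoiding w) (@adj F) by move=> a b /andP[].
have nxu := step_avoiding_neq nuv xv.
have nxv : x != v by apply: step_avoiding_neq xu; rewrite closed_adj_sym.
have [p [pp up allp]] := first_neighbour (subF v) nxu xu.
have [q [pq vq allq]] := first_neighbour (subF u) nxv xv.
have allu : all (fun y => ~~ (u -- y)) (rev (belast x p) ++ q).
  by rewrite all_cat all_rev allp (avoiding_all pq).
have allv : all (fun y => ~~ (v -- y)) (rev p ++ belast x q).
  by rewrite all_cat all_rev allq (avoiding_all pp).
pose w := rev (x :: p) ++ q.
(* The two forms of [w] isolate its first vertex, the only neighbour of [u], and its last, the only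
   neighbour of [v]. *)
have wu : w = last x p :: (rev (belast x p) ++ q).
  by rewrite /w lastI rev_rcons.
have wv : w = rcons (rev p ++ belast x q) (last x q).
  by rewrite /w rev_cons cat_rcons lastI rcons_cat.
rewrite inE; apply/asboolP; exists (u :: rcons w v); last first.
  by rewrite inE mem_rcons inE mem_cat mem_rev mem_head !orbT.
move: nuv; rewrite /tolled_walk negb_or => /andP[/negPf -> /negPf ->].
exists w => //; split.
- by rewrite wu.
- have xsym : path (fun y z => z -- y) x p.
    by rewrite (eq_path (e' := @adj F)) => [|y z]; [exact: sub_path pp | exact: adj_sym].
  (* The reversed path ends at [x], where [q] begins. *)
  rewrite wu /= cat_path rev_path xsym /= -(last_cons x) -rev_rcons -lastI.
  by rewrite rev_cons last_rcons (sub_path (subF u) pq).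
- move=> [|i]; rewrite wu //= ltnS => iw; split=> // ui.
  by move/all_nthP: allu => /(_ u i iw); rewrite ui.
- move=> i; rewrite wv size_rcons ltnS nth_rcons /= leq_eqVlt => /orP[/eqP->|iw].
    by rewrite ltnn eqxx.
  rewrite iw; split=> [vi|iE]; last by rewrite iE ltnn in iw.
  by move/all_nthP: allv => /(_ u i iw); rewrite vi.
Qed.

Lemma t_convexP (C : {set F}) u v x :
  t_convex C -> u \in C -> v \in C -> x \in toll_interval u v -> x \in C.
Proof.
by move=> /forall_inP cC uC vC; move/forall_inP: (cC u uC) => /(_ v vC)/subsetP; apply.
Qed.

Lemma t_convex_small (C : {set F}) : #|C| <= 1 -> t_convex C.
Proof.
move=> /card_le1_eqP C1; apply/forall_inP => u uC; apply/forall_inP => v vC.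
rewrite (C1 _ _ vC uC); apply/subsetP => x; rewrite inE => /asboolP[p].
by rewrite /tolled_walk eqxx => ->; rewrite inE => /eqP->.
Qed.

(** A set of at most one vertex is its own hull, hence too small to be a hull set once [u] and [v]
    differ. *)
Lemma t_hull_number_eq2 u v :
  ~~ closed_adj u v -> t_hull_set [set u; v] -> t_hull_number F = 2.
Proof.
move=> nuv huv; have neq_uv : u != v by move: nuv; rewrite negb_or => /andP[].
rewrite /t_hull_number; case: ex_minnP => n /existsP[S /andP[/eqP hS /eqP cS]] n_min.
apply/eqP; rewrite eqn_leq n_min /=; last first.
  by apply/existsP; exists [set u; v]; rewrite huv cards2 neq_uv.
rewrite -cS ltnNge; apply/negP => S1.
have ST : [set: F] \subset S.
  by rewrite -hS; apply: bigcap_inf; rewrite t_convex_small /=.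
case/negP: neq_uv; apply/eqP.
by move/card_le1_eqP: S1; apply; apply: (subsetP ST).
Qed.

End Graph.

Section StrongProduct.

Variables G H : sgraph.
Hypotheses (connG : connected_graph G) (connH : connected_graph H).

Local Notation GH := (strong_product G H).

Lemma closed_adj_prod (x y : GH) :
  closed_adj x y = closed_adj x.1 y.1 && closed_adj x.2 y.2.
Proof.
case: x y => [a b] [a' b']; rewrite /closed_adj /= /strong_adj /= xpair_eqE.
by case: (a == a'); case: (b == b'); case: (a -- a'); case: (b -- b').
Qed.

(* For [a] and [b] outside N[v.1] and N[v.2], every vertex outside N[v] is
   joined to (a, b) outside N[v] by a copy of [G] and a copy of [H]. *)
Lemma connect_step_avoiding (v x y : GH) (a : G) (b : H) :
  ~~ closed_adj v.1 a -> ~~ closed_adj v.2 b ->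
  ~~ closed_adj v y -> (exists2 z, closed_adj x z & ~~ closed_adj v z) ->
  connect (step_avoiding v) x y.
Proof.
move=> va vb vy [z xz vz].
(* Unlike [step_avoiding v], this relation is symmetric, so paths to (a, b) can be reversed. *)
pose e := [rel s t : GH | [&& s -- t, ~~ closed_adj v s & ~~ closed_adj v t]].
have sub_e : subrel e (step_avoiding v).
  by move=> s t /and3P[st _ vt]; rewrite /step_avoiding st.
have sym_e : symmetric e by move=> s t; rewrite /= strong_adj_sym [X in _ && X]andbC.
have rowE a' : ~~ closed_adj v.1 a' -> forall c d, connect e (a', c) (a', d).
  move=> va' c d; apply: (connect_homo (f := pair a') _ (connH c d)) => s t st.
  by rewrite /= !closed_adj_prod /= (negPf va') /strong_adj /= eqxx st orbT.
have colE b' : ~~ closed_adj v.2 b' -> forall c d, connect e (c, b') (d, b').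
  move=> vb' c d; apply: (connect_homo (f := pair^~ b') _ (connG c d)) => s t st.
  by rewrite /= !closed_adj_prod /= (negPf vb') !andbF /strong_adj /= eqxx st.
(* Some coordinate of [w] is outside the neighbourhood; fixing it while the other one moves to that
   of (a, b) stays outside N[v]. *)
have hub w : ~~ closed_adj v w -> connect e w (a, b).
  case: w => w1 w2; rewrite closed_adj_prod negb_and => /orP[vw|vw].
    exact: connect_trans (rowE _ vw _ _) (colE _ vb _ _).
  exact: connect_trans (colE _ vw _ _) (rowE _ va _ _).
have zy : connect (step_avoiding v) z y.
  apply: connect_sub (connect_trans (hub z vz) _); last first.
    by rewrite (sym_connect_sym sym_e) hub.
  by move=> s t /sub_e/connect1.
case/orP: xz => [/eqP->//|xz].
by apply: connect_trans (connect1 _) zy; rewrite /step_avoiding xz.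
Qed.

(** Each path can take its own target as (a, b), since both coordinates of that target lie outside
    the neighbourhoods to be avoided. *)
Lemma mem_toll_interval_prod (u v x : GH) :
  ~~ closed_adj u.1 v.1 -> ~~ closed_adj u.2 v.2 ->
  (exists2 z, closed_adj x z & ~~ closed_adj u z) ->
  (exists2 z, closed_adj x z & ~~ closed_adj v z) ->
  x \in toll_interval u v.
Proof.
move=> uv1 uv2 xu xv.
have nuv : ~~ closed_adj u v by rewrite closed_adj_prod (negPf uv1).
apply: mem_toll_interval => //.
  apply: (connect_step_avoiding (a := u.1) (b := u.2)) => //; by rewrite closed_adj_sym.
exact: (connect_step_avoiding (a := v.1) (b := v.2)).
Qed.

Lemma t_hull_set_prod (g1 g2 : G) (h1 h2 : H) :
  ~~ closed_adj g1 g2 -> ~~ closed_adj h1 h2 ->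
  @t_hull_set GH [set (g1, h1); (g2, h2)].
Proof.
move=> ng nh; have ng' : ~~ closed_adj g2 g1 by rewrite closed_adj_sym.
have nh' : ~~ closed_adj h2 h1 by rewrite closed_adj_sym.
rewrite /t_hull_set eqEsubset subsetT; apply/subsetP => x _.
apply/bigcapP => C /andP[cC]; rewrite subUset !sub1set => /andP[uC vC].
have outside (a y : GH) :
    ~~ closed_adj a y -> exists2 z, closed_adj y z & ~~ closed_adj a z.
  by exists y; rewrite ?closed_adj_refl.
have u'C : ((g1, h2) : GH) \in C.
  apply: t_convexP cC uC vC _; apply: mem_toll_interval_prod => //=;
  by apply: outside; rewrite closed_adj_prod /= ?(negPf nh) ?(negPf ng') ?andbF.
have v'C : ((g2, h1) : GH) \in C.
  apply: t_convexP cC uC vC _; apply: mem_toll_interval_prod => //=;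
  by apply: outside; rewrite closed_adj_prod /= ?(negPf nh') ?(negPf ng) ?andbF.
(* Replacing one coordinate of [x] by that of (g, h) gives a vertex of N[x] that escapes the
   neighbourhood of a crossed vertex. *)
have near (g g' : G) (h h' : H) : ~~ closed_adj g' g -> ~~ closed_adj h' h ->
    closed_adj ((g, h) : GH) x ->
    (exists2 z, closed_adj x z & ~~ closed_adj ((g, h') : GH) z) /\
    (exists2 z, closed_adj x z & ~~ closed_adj ((g', h) : GH) z).
  rewrite closed_adj_prod => ngg nhh /andP[/= gx hx]; split.
    exists (x.1, h); rewrite closed_adj_prod /= ?(negPf nhh) ?andbF //.
    by rewrite closed_adj_refl closed_adj_sym.
  exists (g, x.2); rewrite closed_adj_prod /= ?(negPf ngg) //.
  by rewrite closed_adj_refl closed_adj_sym gx.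
(* If [x] is near one of the two given vertices, the crossed pair captures it; otherwise [x] is its
   own witness for the given pair. *)
have [/(near _ g2 _ h2 ng' nh')[xu' xv']|xu] :=
  boolP (closed_adj ((g1, h1) : GH) x).
  exact: t_convexP cC u'C v'C (mem_toll_interval_prod _ _ xu' xv').
have [/(near _ g1 _ h1 ng nh)[xv' xu']|xv] :=
  boolP (closed_adj ((g2, h2) : GH) x).
  exact: t_convexP cC u'C v'C (mem_toll_interval_prod _ _ xu' xv').
apply: t_convexP cC uC vC _.
exact: mem_toll_interval_prod _ _ (outside _ _ xu) (outside _ _ xv).
Qed.

End StrongProduct.

Theorem theorem5p1 (G H : sgraph)
    (connG : connected_graph G) (connH : connected_graph H)
    (ncG : ~ complete_graph G) (ncH : ~ complete_graph H) :
  t_hull_number (strong_product G H) = 2.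
Proof.
have [g1 [g2 ng]] := not_complete_graphP ncG.
have [h1 [h2 nh]] := not_complete_graphP ncH.
apply: (@t_hull_number_eq2 (strong_product G H) (g1, h1) (g2, h2)).
  by rewrite closed_adj_prod (negPf ng).
exact: t_hull_set_prod.
Qed.
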